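(* Let $p$ be a prime and let $T$ be a plane bipartite tree with $N=pr$ edges, where $\gcd(p,r)=1$, with $n$ white vertices $v_1,\ldots,v_n$ of degrees $k_1,\ldots,k_n$ and $m$ black vertices $u_1,\ldots,u_m$ of degrees $l_1,\ldots,l_m$. Let $$b(z)=\prod_{i=1}^n (z-x_i)^{k_i}$$ be a normalized model of $T$ with respect to a number field $K$ and a prime divisor $\rho$ of $K$ dividing $p$, where $x_i\in K$ is the coordinate of $v_i$ and the white vertices are numbered so that $x_1=0$. Let $v_\rho$ be the valuation of $K$ at $\rho$ and $e_K=v_\rho(p)$. If the passport of $T$ is white-indecomposable (with respect to $p$), then $$v_\rho(x_i)=\frac{e_K}{n-1}\quad\text{for all } i>1.$$
   Context: A plane bipartite tree is a tree embedded in the plane with vertices properly coloured white and black. If $T$ has $N$ edges, $n$ white vertices of degrees $k_1,\ldots,k_n$ and $m$ black vertices of degrees $l_1,\ldots,l_m$ (so $n+m=N+1$), its passport is $P=\langle k_1,\ldots,k_n\,|\,l_1,\ldots,l_m\rangle$. The passport is white-decomposable (with respect to $p$) if there is a nonempty proper subset of the white vertices whose sum of degrees $k_{i_1}+\cdots+k_{i_t}$ is divisible by $p$; otherwise it is white-indecomposable. A Shabat polynomial for $T$ is here a polynomial $b\in\mathbb{C}[z]$ of degree $N$ whose finite critical values all lie in $\{0,c\}$ for some $c\neq 0$, such that $b^{-1}([0,c])$, where $[0,c]$ is the segment joining $0$ and $c$, with the points of $b^{-1}(0)$ as white vertices and the points of $b^{-1}(c)$ as black vertices, is isomorphic to $T$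 as a plane bipartite tree (i.e. via an orientation-preserving homeomorphism of the plane). The coordinate of a vertex is its position as a complex number; a white vertex of degree $k$ is a root of $b$ of multiplicity $k$, and a black vertex of degree $l$ is a root of $b-c$ of multiplicity $l$. Let $K$ be a number field containing the coordinates of all white and black vertices and the number $c$ (the big definition field), and let $\rho$ be a prime divisor (finite place) of $K$ dividing $p$, with normalized (integer-valued, surjective on $K^\times$) valuation $v_\rho$. An element $x\in K$ is $\rho$-integral if $v_\rho(x)\ge 0$. A Shabat polynomial $b$ of $T$ is a normalized model of $T$ (with respect to $K$, $\rho$) if: its leading coefficient is $1$; some white vertex is at the origin and some black vertex is at the point $1$; and the coordinates of all white and black vertices are $\rho$-integral. *)

(* Defs.v *)
From HB Require Import structures.
From mathcomp Require Import all_boot all_order all_algebra all_field.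
From mathcomp Require Import complex.
From mathcomp Require Import classical_sets reals topology normedtype.

Set Implicit Arguments.
Unset Strict Implicit.
Unset Printing Implicit Defensive.

Import Order.TTheory GRing.Theory Num.Theory numFieldNormedType.Exports.

Local Open Scope classical_set_scope.
Local Open Scope ring_scope.

(* The complex numbers over [R], packed so that [R[i]] carries the topology of
   its modulus. *)
Definition Cplx (R : realType) : numClosedFieldType := complex R.

Definition of_real (R : realType) (t : R) : Cplx R := real_complex R t.

(* The edge [e] is the arc [arc e], parametrised by [0, 1] from its white end
   to its black end. *)
Record plane_bipartite_graph (R : realType) (N n m : nat) := PlaneBipartiteGraph {
  white : 'I_n -> Cplx R;
  black : 'I_m -> Cplx R;
  wend : 'I_N -> 'I_n;
  bend : 'I_N -> 'I_m;
  arc : 'I_N -> R -> Cplx R;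
  white_inj : injective white;
  black_inj : injective black;
  white_neq_black : forall i j, white i <> black j;
  arc0 : forall e, arc e 0 = white (wend e);
  arc1 : forall e, arc e 1 = black (bend e);
  arc_continuous : forall e, {within `[0, 1], continuous (arc e)};
  arc_inj : forall e s t, 0 <= s <= 1 -> 0 <= t <= 1 ->
    arc e s = arc e t -> s = t;
  arc_disjoint : forall e f s t, 0 < s < 1 -> 0 < t < 1 ->
    arc e s = arc f t -> e = f;
  arc_neq_white : forall e s i, 0 < s < 1 -> arc e s <> white i;
  arc_neq_black : forall e s j, 0 < s < 1 -> arc e s <> black j
}.

Definition adjacent (R : realType) (N n m : nat)
    (G : plane_bipartite_graph R N n m) : rel ('I_n + 'I_m)%type :=
  fun u w => match u, w with
  | inl i, inr j => [exists e, (wend G e == i) && (bend G e == j)]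
  | inr j, inl i => [exists e, (wend G e == i) && (bend G e == j)]
  | _, _ => false
  end.

(* In a simple graph a duplicate-free closed walk with more than two vertices
   is a genuine cycle; those with two run back and forth along one edge. *)
Record is_tree (R : realType) (N n m : nat)
    (G : plane_bipartite_graph R N n m) : Prop := IsTree {
  tree_nonempty : (0 < n + m)%N;
  tree_simple : forall e f, wend G e = wend G f -> bend G e = bend G f -> e = f;
  tree_connected : forall u w, connect (adjacent G) u w;
  tree_acyclic : forall s : seq ('I_n + 'I_m)%type,
    ucycle (adjacent G) s -> (size s <= 2)%N
}.

Record plane_bipartite_tree (R : realType) (N n m : nat) := PlaneBipartiteTree {
  tree_graph :> plane_bipartite_graph R N n m;
  tree_graph_is_tree : is_tree tree_graph
}.

Definition white_degree (R : realType) (N n m : nat)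
    (G : plane_bipartite_graph R N n m) (i : 'I_n) : nat :=
  #|[set e | wend G e == i]%SET|.

Definition black_degree (R : realType) (N n m : nat)
    (G : plane_bipartite_graph R N n m) (j : 'I_m) : nat :=
  #|[set e | bend G e == j]%SET|.

Definition passport (R : realType) (N n m : nat)
    (G : plane_bipartite_graph R N n m) : n.-tuple nat * m.-tuple nat :=
  ([tuple white_degree G i | i < n], [tuple black_degree G j | j < m]).

Definition white_decomposable (p n m : nat) (P : n.-tuple nat * m.-tuple nat)
    : Prop :=
  exists S : {set 'I_n},
    [/\ S != finset.set0, S != finset.setT & (p %| \sum_(i in S) tnth P.1 i)%N].

Definition white_indecomposable (p n m : nat) (P : n.-tuple nat * m.-tuple nat)
    : Prop := ~ white_decomposable p P.

(* The subset of the plane drawn by [G]. *)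
Definition support (R : realType) (N n m : nat)
    (G : plane_bipartite_graph R N n m) : set (Cplx R) :=
  [set z | exists e, exists2 t : R, 0 <= t <= 1 & z = arc G e t]
    `|` range (white G) `|` range (black G).

Definition plane_homeomorphism (R : realType) (h : Cplx R -> Cplx R) : Prop :=
  continuous h /\
  exists g : Cplx R -> Cplx R, [/\ continuous g, cancel h g & cancel g h].

(* [h] has local degree 1 at every [z]: the loop [w |-> h (z + w) - h z] on the
   unit circle is homotopic to [w |-> w] through loops avoiding 0. *)
Definition orientation_preserving (R : realType) (h : Cplx R -> Cplx R) : Prop :=
  forall z : Cplx R, exists H : R * Cplx R -> Cplx R,
    [/\ {within [set tw : R * Cplx R | 0 <= tw.1 <= 1 /\ `|tw.2| = 1],
          continuous H},
        forall (t : R) (w : Cplx R), 0 <= t <= 1 -> `|w| = 1 -> H (t, w) != 0,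
        forall w : Cplx R, `|w| = 1 -> H (0, w) = h (z + w) - h z
      & forall w : Cplx R, `|w| = 1 -> H (1, w) = w].

Definition segment0 (R : realType) (c : Cplx R) : set (Cplx R) :=
  [set z | exists2 t : R, 0 <= t <= 1 & z = of_real t * c].

(* [h] is an isomorphism of plane bipartite trees from [T] onto the preimage of
   the segment [0, c] under [b]. *)
Record plane_tree_isomorphism (R : realType) (N n m : nat)
    (T : plane_bipartite_tree R N n m) (b : {poly Cplx R}) (c : Cplx R)
    (h : Cplx R -> Cplx R) : Prop := PlaneTreeIsomorphism {
  iso_homeo : plane_homeomorphism h;
  iso_orientation : orientation_preserving h;
  iso_support : h @` support T = [set z | segment0 c b.[z]];
  iso_white : h @` range (white T) = [set z | b.[z] = 0];
  iso_black : h @` range (black T) = [set z | b.[z] = c]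
}.

(* [x i] and [y j] are the coordinates of the white vertex [i] and the black
   vertex [j] of [T]. *)
Record shabat_polynomial (R : realType) (N n m : nat)
    (T : plane_bipartite_tree R N n m) (b : {poly Cplx R}) (c : Cplx R)
    (x : 'I_n -> Cplx R) (y : 'I_m -> Cplx R) : Prop := ShabatPolynomial {
  shabat_size : size b = N.+1;
  shabat_c_neq0 : c != 0;
  shabat_critical : forall z, root b^`() z -> b.[z] = 0 \/ b.[z] = c;
  shabat_tree : exists h, [/\ plane_tree_isomorphism T b c h,
    forall i, h (white T i) = x i & forall j, h (black T j) = y j]
}.

(* A finite place, given by its normalized valuation. The valuation of 0 is
   +oo, so the value of the function at 0 is left unconstrained. *)
Record finite_place (K : fieldExtType rat) := FinitePlace {
  place_val :> K -> int;
  place_valM : forall x y : K, x != 0 -> y != 0 ->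
    place_val (x * y) = place_val x + place_val y;
  place_valD : forall x y : K, x != 0 -> y != 0 -> x + y != 0 ->
    Num.min (place_val x) (place_val y) <= place_val (x + y);
  place_val_surj : forall k : int, exists2 x : K, x != 0 & place_val x = k
}.

Definition place_divides (K : fieldExtType rat) (rho : finite_place K) (p : nat)
    : Prop := 0 < rho p%:R.

Definition place_integral (K : fieldExtType rat) (rho : finite_place K) (x : K)
    : Prop := x = 0 \/ 0 <= rho x.

(* The number field [K] is embedded in the complex numbers by [iota]; that it
   contains [c] and all vertex coordinates is expressed by giving those as
   elements of [K]. *)
Record normalized_model (R : realType) (N n m : nat)
    (T : plane_bipartite_tree R N n m) (K : fieldExtType rat)
    (iota : {rmorphism K -> Cplx R}) (rho : finite_place K)
    (b : {poly Cplx R}) (c : K) (x : 'I_n -> K) (y : 'I_m -> K) : Prop :=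
  NormalizedModel {
  model_shabat : shabat_polynomial T b (iota c) (iota \o x) (iota \o y);
  model_monic : lead_coef b = 1;
  model_white0 : exists i, x i = 0;
  model_black1 : exists j, y j = 1;
  model_white_integral : forall i, place_integral rho (x i);
  model_black_integral : forall j, place_integral rho (y j)
}.

(* Main.v *)
Require Import Defs.
From HB Require Import structures.
From mathcomp Require Import all_boot all_order all_algebra all_field.
From mathcomp Require Import complex.
From mathcomp Require Import classical_sets reals topology normedtype.
From mathcomp Require Import zify.

Set Implicit Arguments.
Unset Strict Implicit.
Unset Printing Implicit Defensive.

Import Order.TTheory GRing.Theory Num.Theory numFieldNormedType.Exports.

Local Open Scope ring_scope.

(** Write [k i] for the degree of the white vertex [x i], and [G] for the
    numerator [\sum_i k i * \prod_(j != i) ('X - x j)] of the logarithmic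
    derivative [b' / b]. A root of [G] is a critical point of [b] that is not
    a white vertex, so it is a black vertex; as [G] has leading coefficient
    [\sum_i k i = N], it equals [N * Q] with [Q] a product of factors ['X - y]
    over black vertices [y] ([log_deriv_num_roots]). The whole argument compares
    the two expressions of [G] at the place.

    The key point is that if [G] vanishes modulo the maximal ideal, then so does
    [\sum_i k i / ('X - x i)]; its residue at [0] is the sum of the [k i] over
    the [x i] that reduce to [0], so that sum is divisible by [p]
    ([sum_cluster_ideal]). If the passport is white-indecomposable and one [x i]
    is [0], all the [x i] must reduce to [0] ([indecomposable_ideal]).

    As [N] is divisible by [p], this applies to [x]: all white vertices lie in
    the maximal ideal. Then [c = b(1)] is a unit, hence so is every black vertex
    [y], because [b(y) = c]. Evaluating [G = N * Q] at the white vertex [0]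
    shows that the valuations of the other [n - 1] white vertices add up to
    [e = v(N) = v(p)]; the degree of the vertex at [0] is prime to [p] by
    indecomposability. Let [mu] be the least of these valuations, reached at
    [t]. Then [e >= (n - 1) mu]. If this were strict, the numerator of the
    rescaled points [x i / t], which is [N / t ^ (n - 1) * Q(t 'X)], would again
    vanish modulo the maximal ideal, and the key point would put [t / t = 1] in
    that ideal. Hence [e = (n - 1) mu], and a sum of [n - 1] terms that are at
    least [mu] equals [(n - 1) mu] only if every term is [mu]
    ([indecomposable_valuation]). *)

(** * The numerator of a logarithmic derivative *)

Lemma deriv_prod_seq (F : comNzRingType) (I : eqType) (r : seq I)
    (f : I -> {poly F}) :
  uniq r ->
  (\prod_(i <- r) f i)^`() =
    \sum_(i <- r) (f i)^`() * \prod_(j <- r | j != i) f j.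
Proof.
elim: r => [|a r IHr] /=; first by rewrite !big_nil derivC.
case/andP=> a_notin r_uniq; rewrite !big_cons derivM IHr // eqxx.
congr (_ * _ + _).
  rewrite big_seq [RHS]big_seq_cond; apply: eq_bigl => j.
  by case: (boolP (j \in r)) => // j_in; rewrite (memPn a_notin).
rewrite big_distrr /= big_seq [RHS]big_seq; apply: eq_bigr => i i_in.
rewrite big_cons eq_sym (memPn a_notin) //.
by rewrite mulrCA.
Qed.

(** With [b] the product of the [('X - x i) ^+ k i], this is the numerator of
    [b' / b] over the common denominator [\prod_i ('X - x i)]. *)
Definition log_deriv_num (F : comNzRingType) n (k : 'I_n -> nat)
    (x : 'I_n -> F) : {poly F} :=
  \sum_i (k i)%:R *: \prod_(j | j != i) ('X - (x j)%:P).

Section LogDerivNum.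

Variables (F : comNzRingType) (n : nat) (k : 'I_n -> nat).
Implicit Type x : 'I_n -> F.

(** Each factor of [b] contributes [k i / ('X - x i)] to [b' / b]. *)
Lemma log_deriv_numE x :
  (\prod_i ('X - (x i)%:P)) * (\prod_i ('X - (x i)%:P) ^+ k i)^`() =
  log_deriv_num k x * \prod_i ('X - (x i)%:P) ^+ k i.
Proof.
rewrite deriv_prod_seq ?index_enum_uniq // big_distrr big_distrl /=.
apply: eq_bigr => i _; rewrite deriv_exp derivXsubC mul1r.
rewrite (bigD1 i) //= [X in _ = _ * X](bigD1 i) //= -scaler_nat.
case: (k i) => [|d]; first by rewrite !scale0r !mul0r mulr0.
rewrite exprS /= -!(scalerAl, scalerAr); congr (_ *: _).
by rewrite -!mulrA [RHS]mulrCA.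
Qed.

Lemma horner_log_deriv_num x i :
  (log_deriv_num k x).[x i] = (k i)%:R * \prod_(j | j != i) (x i - x j).
Proof.
rewrite horner_sum (bigD1 i) //= hornerZ horner_prod [X in _ + X]big1.
  by rewrite addr0; congr (_ * _); apply: eq_bigr => j _; rewrite hornerXsubC.
move=> j j_neq; rewrite hornerZ horner_prod (bigD1 i) 1?eq_sym //=.
by rewrite hornerXsubC subrr mul0r mulr0.
Qed.

Lemma size_prod_off x i : size (\prod_(j < n | j != i) ('X - (x j)%:P)) = n.
Proof.
rewrite -big_filter size_prod_XsubC size_filter -sum1_count.
rewrite sum1_card; have := cardC1 i; rewrite card_ord => ->.
by case: n i => // -[].
Qed.

Lemma size_log_deriv_num x : (size (log_deriv_num k x) <= n)%N.
Proof.
apply: (leq_trans (size_sum _ _ _)); apply/bigmax_leqP => i _.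
apply: (leq_trans (size_scale_leq _ _)).
by rewrite size_prod_off.
Qed.

Lemma coef_log_deriv_num x :
  (log_deriv_num k x)`_n.-1 = (\sum_i k i)%:R.
Proof.
rewrite coef_sum natr_sum; apply: eq_bigr => i _; rewrite coefZ.
have prod_monic := monic_prod_XsubC (index_enum 'I_n) (predC1 i) x.
move/monicP: prod_monic; rewrite lead_coefE size_prod_off => ->.
by rewrite mulr1.
Qed.

(** The exponent is the number of factors in each term of the numerator. *)
Lemma log_deriv_num_scale (t : F) x :
  log_deriv_num k (fun i => t * x i) \Po (t *: 'X) =
  t ^+ n.-1 *: log_deriv_num k x.
Proof.
rewrite /log_deriv_num linear_sum scaler_sumr; apply: eq_bigr => i _ /=.
rewrite comp_polyZ scalerA [_ * (k i)%:R]mulrC -scalerA; congr (_ *: _).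
rewrite rmorph_prod /=.
rewrite (eq_bigr (fun j => t *: ('X - (x j)%:P))) => [|j _]; last first.
  by rewrite comp_polyB comp_polyX comp_polyC scalerBr polyCM mul_polyC.
rewrite scaler_prod; congr (_ *: _); rewrite prodr_const.
by have := cardC1 i; rewrite card_ord => ->.
Qed.

End LogDerivNum.

Lemma map_log_deriv_num (F F' : comNzRingType) (f : {rmorphism F -> F'})
    n (k : 'I_n -> nat) (x : 'I_n -> F) :
  map_poly f (log_deriv_num k x) = log_deriv_num k (f \o x).
Proof.
rewrite rmorph_sum; apply: eq_bigr => i _.
by rewrite /= map_polyZ rmorph_nat map_prod_XsubC.
Qed.

(** Away from the roots of [b], a root of the numerator is a critical point of
    [b]; and the numerator does not vanish at a root [x i] of [b], since the
    [x j] are distinct and [k i] is nonzero. *)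
Lemma log_deriv_num_roots (C : numClosedFieldType) n (k : 'I_n -> nat)
    (x : 'I_n -> C) (c : C) :
  let b := \prod_i ('X - (x i)%:P) ^+ k i in
  (0 < n)%N -> (forall i, 0 < k i)%N -> injective x ->
  (forall z, root b^`() z -> b.[z] = 0 \/ b.[z] = c) ->
  exists2 r : seq C, {in r, forall z, b.[z] = c} &
    log_deriv_num k x = (\sum_i k i)%:R *: \prod_(z <- r) ('X - z%:P).
Proof.
move=> b n_gt0 k_gt0 x_inj crit; set G := log_deriv_num k x.
have sum_neq0 : (\sum_i k i)%:R != 0 :> C.
  rewrite pnatr_eq0 -lt0n (bigD1 (Ordinal n_gt0)) //=.
  by rewrite addn_gt0 k_gt0.
have lead_G : lead_coef G = (\sum_i k i)%:R.
  rewrite lead_coefE -(coef_log_deriv_num k x) -/G.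
  suff -> : size G = n by [].
  apply/eqP; rewrite eqn_leq size_log_deriv_num /= leqNgt.
  apply/negP => size_lt; move: sum_neq0; rewrite -(coef_log_deriv_num k x).
  by rewrite nth_default ?eqxx // -ltnS prednK.
have [r G_eq] := closed_field_poly_normal G.
exists r; last by rewrite -lead_G.
have lead_neq0 : lead_coef G != 0 by rewrite lead_G.
move=> z z_in.
have Gz : G.[z] = 0.
  by apply/rootP; rewrite G_eq rootZ // root_prod_XsubC.
have z_neq i : z != x i.
  apply/eqP => z_eq; move/eqP: Gz; rewrite z_eq horner_log_deriv_num.
  rewrite mulf_eq0 pnatr_eq0 (gtn_eqF (k_gt0 i)) /= => /prodf_eq0[j j_neq].
  by rewrite subr_eq0 (inj_eq x_inj) eq_sym (negPf j_neq).
case: (crit z) => // [|/eqP].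
  (* Here the numerator vanishes at z but no factor z - x j does. *)
  have := congr1 (horner^~ z) (log_deriv_numE k x); rewrite !hornerM Gz mul0r.
  move/eqP; rewrite mulf_eq0 => /orP[|/eqP/rootP //].
  rewrite horner_prod => /prodf_eq0[j _].
  by rewrite hornerXsubC subr_eq0 (negPf (z_neq j)).
rewrite horner_prod => /prodf_eq0[j _].
by rewrite horner_exp hornerXsubC expf_eq0 subr_eq0 (negPf (z_neq j)) andbF.
Qed.

(** * The valuation ring of a finite place *)

(** The value of a place at [0] is arbitrary, so [0] is added by hand. *)
Definition val_ring (K : fieldExtType rat) (rho : finite_place K) : {pred K} :=
  fun x => (x == 0) || (0 <= rho x).

Definition val_ideal (K : fieldExtType rat) (rho : finite_place K) : {pred K} :=
  fun x => (x == 0) || (0 < rho x).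

Section FinitePlace.

Variables (K : fieldExtType rat) (rho : finite_place K).
Local Notation O := (val_ring rho).
Local Notation M := (val_ideal rho).

Lemma natr_neq0 k : (0 < k)%N -> k%:R != 0 :> K.
Proof.
move=> k_gt0; rewrite -(rmorph_nat (in_alg K)) fmorph_eq0 pnatr_eq0.
by rewrite -lt0n.
Qed.

Lemma place_val1 : rho 1 = 0.
Proof.
have := place_valM rho (oner_neq0 K) (oner_neq0 K).
by rewrite mulr1 => /eqP; rewrite -subr_eq0 opprD addNKr oppr_eq0 => /eqP.
Qed.

Lemma place_valN x : x != 0 -> rho (- x) = rho x.
Proof.
move=> x_neq0; have N1_neq0 : -1 != 0 :> K by rewrite oppr_eq0 oner_neq0.
rewrite -mulN1r place_valM //; have := place_valM rho N1_neq0 N1_neq0.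
by rewrite mulrNN mulr1 place_val1; lia.
Qed.

Lemma place_valV x : x != 0 -> rho x^-1 = - rho x.
Proof.
move=> x_neq0; have := @place_valM _ rho x x^-1 x_neq0.
by rewrite mulfV // place_val1 invr_eq0 => /(_ x_neq0); lia.
Qed.

Lemma place_val_prod (I : Type) (s : seq I) (P : pred I) (f : I -> K) :
  (forall i, P i -> f i != 0) ->
  rho (\prod_(i <- s | P i) f i) = \sum_(i <- s | P i) rho (f i).
Proof.
move=> f_neq0; suff [] : \prod_(i <- s | P i) f i != 0 /\
  rho (\prod_(i <- s | P i) f i) = \sum_(i <- s | P i) rho (f i) by [].
elim/big_rec2: _ => [|i _ y Pi [y_neq0 <-]].
  by rewrite oner_neq0 place_val1.
by rewrite mulf_neq0 ?f_neq0 // place_valM ?f_neq0.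
Qed.

Lemma place_valX x k : x != 0 -> rho (x ^+ k) = rho x *+ k.
Proof.
move=> x_neq0; elim: k => [|k IHk]; first by rewrite expr0 place_val1.
by rewrite exprS mulrS place_valM ?expf_neq0 // IHk.
Qed.

Fact val_ideal_zmod_closed : zmod_closed M.
Proof.
split=> [|x y]; rewrite !unfold_in ?eqxx //.
have [-> _|x_neq0 /= vx] := eqVneq x 0; have [->|y_neq0 /= vy] := eqVneq y 0.
- by rewrite subr0 eqxx.
- by rewrite sub0r oppr_eq0 place_valN // vy orbT.
- by rewrite subr0 vx orbT.
have [//|xy_neq0 /=] := eqVneq (x - y) 0.
have Ny_neq0 : - y != 0 by rewrite oppr_eq0.
apply: lt_le_trans (place_valD rho x_neq0 Ny_neq0 xy_neq0).
by rewrite lt_min vx place_valN.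
Qed.

Fact val_ring_subring_closed : subring_closed O.
Proof.
split=> [|x y|x y]; rewrite !unfold_in ?place_val1 ?lexx ?orbT //.
  have [-> _|x_neq0 /= vx] := eqVneq x 0; have [->|y_neq0 /= vy] := eqVneq y 0.
  - by rewrite subr0 eqxx.
  - by rewrite sub0r oppr_eq0 place_valN // vy orbT.
  - by rewrite subr0 vx orbT.
  have [//|xy_neq0 /=] := eqVneq (x - y) 0.
  have Ny_neq0 : - y != 0 by rewrite oppr_eq0.
  apply: le_trans (place_valD rho x_neq0 Ny_neq0 xy_neq0).
  by rewrite le_min vx place_valN.
have [->|x_neq0 /= vx] := eqVneq x 0; first by rewrite mul0r eqxx.
have [->|y_neq0 /= vy] := eqVneq y 0; first by rewrite mulr0 eqxx.
by rewrite place_valM // addr_ge0 ?orbT.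
Qed.

HB.instance Definition _ :=
  GRing.isZmodClosed.Build K (val_ideal rho) val_ideal_zmod_closed.
HB.instance Definition _ :=
  GRing.isSubringClosed.Build K (val_ring rho) val_ring_subring_closed.

Lemma val_idealW x : x \in M -> x \in O.
Proof. by rewrite !unfold_in => /orP[->//|/ltW ->]; rewrite orbT. Qed.

Lemma val_idealMr x y : x \in O -> y \in M -> x * y \in M.
Proof.
rewrite !unfold_in; have [->|x_neq0 /= vx] := eqVneq x 0.
  by rewrite mul0r eqxx.
have [->|y_neq0 /= vy] := eqVneq y 0; first by rewrite mulr0 eqxx.
by rewrite place_valM // ltr_wpDl ?orbT.
Qed.

Lemma val_ideal_neq0 x : x \notin M -> x != 0.
Proof. by apply: contraNneq => ->; rewrite rpred0. Qed.

Lemma place_val_unit x : x \in O -> x \notin M -> rho x = 0.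
Proof.
rewrite !unfold_in negb_or -leNgt => vx /andP[x_neq0 vx'].
by move: vx; rewrite (negPf x_neq0) /= => vx; apply/le_anti/andP.
Qed.

Lemma place_val0_notin x : x != 0 -> rho x = 0 -> x \notin M.
Proof. by move=> x_neq0 vx; rewrite unfold_in (negPf x_neq0) vx ltxx. Qed.

(** The maximal ideal is prime. *)
Lemma mul_notin_ideal x y : x \in O -> y \in O ->
  x \notin M -> y \notin M -> x * y \notin M.
Proof.
move=> x_O y_O x_M y_M; have x_neq0 := val_ideal_neq0 x_M.
have y_neq0 := val_ideal_neq0 y_M.
by rewrite place_val0_notin ?mulf_neq0 // place_valM // !place_val_unit.
Qed.

Lemma one_notin_ideal : 1 \notin M.
Proof. by rewrite place_val0_notin ?oner_neq0 ?place_val1. Qed.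

Lemma prod_notin_ideal (I : eqType) (s : seq I) (P : pred I) (f : I -> K) :
  (forall i, i \in s -> P i -> f i \in O) ->
  (forall i, i \in s -> P i -> f i \notin M) ->
  \prod_(i <- s | P i) f i \notin M.
Proof.
move=> f_O f_M; rewrite big_seq_cond.
suff [] : \prod_(i <- s | (i \in s) && P i) f i \in O /\
  \prod_(i <- s | (i \in s) && P i) f i \notin M by [].
elim/big_rec: _ => [|i y /andP[i_s Pi] [y_O y_M]].
  by rewrite rpred1 one_notin_ideal.
by rewrite rpredM ?mul_notin_ideal ?f_O ?f_M.
Qed.

(** If [p] does not divide [k], a Bezout relation between [p] and [k] would put
    [1] in the maximal ideal. *)
Lemma place_divides_natP p k :
  place_divides rho p -> prime p -> (k%:R \in M) = (p %| k)%N.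
Proof.
move=> rho_p p_prime.
have p_M : p%:R \in M by rewrite unfold_in; apply/orP; right.
apply/idP/idP=> [k_M|/dvdnP[q ->]]; last first.
  by rewrite natrM val_idealMr ?rpred_nat.
apply/contraLR: k_M; rewrite -prime_coprime //.
case/coprimeP=> [|[u v] /= bezout]; first exact: prime_gt0.
apply/negP => k_M; suff : 1 \in M by rewrite unfold_in oner_eq0 place_val1.
have -> : 1 = u%:R * p%:R - v%:R * k%:R :> K.
  by rewrite -!natrM -natrB ?bezout // ltnW // -subn_gt0 bezout.
by rewrite rpredB ?val_idealMr ?rpred_nat.
Qed.

Lemma polyOver_idealM f g :
  f \is a polyOver O -> g \is a polyOver M -> f * g \is a polyOver M.
Proof.
move=> /polyOverP f_O /polyOverP g_M; apply/polyOverP => i; rewrite coefM.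
by apply: rpred_sum => j _; apply: val_idealMr.
Qed.

Lemma polyOver_congr_prod (I : Type) (s : seq I) (P : pred I)
    (f g : I -> {poly K}) :
  (forall i, P i -> f i \is a polyOver O) ->
  (forall i, P i -> g i \is a polyOver O) ->
  (forall i, P i -> f i - g i \is a polyOver M) ->
  \prod_(i <- s | P i) f i - \prod_(i <- s | P i) g i \is a polyOver M.
Proof.
move=> f_O g_O fg_M.
elim: s => [|i s IHs]; first by rewrite !big_nil subrr rpred0.
rewrite !big_cons; case: ifP => // Pi.
set F := \prod_(j <- s | P j) f j; set G := \prod_(j <- s | P j) g j.
have -> : f i * F - g i * G = f i * (F - G) + G * (f i - g i).
  by rewrite !mulrBr addrA [f i * G]mulrC subrK [g i * G]mulrC.
rewrite rpredD ?polyOver_idealM ?f_O ?fg_M //.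
exact: rpred_prod.
Qed.

(** * Reduction at the place *)

(** Let [a] be the number of [u i] in the maximal ideal, and [B] the product of
    the ['X - u j] over the others, so that [B] has a unit as constant
    coefficient. Modulo the maximal ideal, the product over [j != i] is
    ['X^(a - 1) * B] if [u i] is in the ideal, and is divisible by ['X^a]
    otherwise. Hence the coefficient of the numerator at degree [a - 1] is the
    sum of the [k i] over the cluster times that unit. This computes the residue
    at [0] of the reduced logarithmic derivative without passing to the residue
    field. *)
Lemma sum_cluster_ideal n (k : 'I_n -> nat) (u : 'I_n -> K) :
  (forall i, u i \in O) -> log_deriv_num k u \is a polyOver M ->
  (\sum_(i | u i \in M) k i)%:R \in M.
Proof.
move=> u_O /polyOverP G_M; pose A := [pred i | u i \in M].
case: (pickP A) => [i0 Ai0 | A0]; last by rewrite big_pred0 ?rpred0.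
have A_gt0 : (0 < #|A|)%N by apply/card_gt0P; exists i0.
pose B := \prod_(j | u j \notin M) ('X - (u j)%:P).
have B0_O : B`_0 \in O.
  by apply/polyOverP/rpred_prod => j _; rewrite polyOverXsubC.
have B0_M : B`_0 \notin M.
  rewrite -horner_coef0 horner_prod prod_notin_ideal // => j _ j_B.
    by rewrite hornerXsubC sub0r rpredN.
  by rewrite hornerXsubC sub0r rpredN.
have congr_off i : \prod_(j | j != i) ('X - (u j)%:P) -
    'X^#|[pred j | (j != i) && (u j \in M)]| *
      \prod_(j | (j != i) && (u j \notin M)) ('X - (u j)%:P)
    \is a polyOver M.
  rewrite (bigID A) /= -mulrBl mulrC polyOver_idealM //.
    by apply: rpred_prod => j _; rewrite polyOverXsubC.
  rewrite -prodr_const; apply: polyOver_congr_prod => j; rewrite ?inE.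
  - by rewrite polyOverXsubC.
  - by rewrite polyOverX.
  by case/andP=> _ j_A; rewrite addrAC subrr sub0r rpredN polyOverC.
have coef_off i : (\prod_(j | j != i) ('X - (u j)%:P))`_#|A|.-1 -
    (u i \in M)%:R * B`_0 \in M.
  have /polyOverP/(_ #|A|.-1) := congr_off i; rewrite coefB coefXnM.
  case: (boolP (u i \in M)) => i_A.
    have -> : #|[pred j | (j != i) && (u j \in M)]| = #|A|.-1.
      rewrite (cardD1 i A) inE i_A add1n /=; apply: eq_card => j.
      by rewrite !inE.
    rewrite ltnn subnn mul1r; congr (_ - _`_0 \in M).
    congr polyseq; apply: eq_bigl => j; case: (eqVneq j i) => [->|] //=.
    by rewrite i_A.
  have -> : #|[pred j | (j != i) && (u j \in M)]| = #|A|.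
    apply: eq_card => j; rewrite !inE; case: eqVneq => [->|] //=.
    by rewrite (negPf i_A).
  by rewrite mul0r ltn_predL A_gt0.
have KB_M : (\sum_(i | u i \in M) k i)%:R * B`_0 \in M.
  have -> : (\sum_(i | u i \in M) k i)%:R * B`_0 =
      (log_deriv_num k u)`_#|A|.-1 -
      \sum_i (k i)%:R * ((\prod_(j | j != i) ('X - (u j)%:P))`_#|A|.-1 -
                         (u i \in M)%:R * B`_0).
    apply: (canRL (addrK _)); rewrite coef_sum natr_sum big_mkcond mulr_suml.
    rewrite -big_split; apply: eq_bigr => i _ /=; rewrite coefZ.
    by case: ifP => _; rewrite ?mul1r ?mul0r ?subr0 ?add0r // -mulrDr subrKC.
  by rewrite rpredB ?rpred_sum // => i _; rewrite val_idealMr ?rpred_nat.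
by apply: contraLR KB_M => K_M; rewrite mul_notin_ideal ?rpred_nat.
Qed.

(** The [u i] in the maximal ideal form a nonempty set, as [u i0] is one of
    them, and [p] divides its sum of degrees; so it is everything. *)
Lemma indecomposable_ideal p n (k : 'I_n -> nat) (u : 'I_n -> K) (i0 : 'I_n) :
  place_divides rho p -> prime p ->
  (forall S : {set 'I_n}, (p %| \sum_(i in S) k i)%N ->
     S = finset.set0 \/ S = finset.setT) ->
  u i0 = 0 -> (forall i, u i \in O) -> log_deriv_num k u \is a polyOver M ->
  forall i, u i \in M.
Proof.
move=> rho_p p_prime indec u0 u_O G_M i.
have := sum_cluster_ideal u_O G_M.
rewrite (place_divides_natP _ rho_p) // => p_dvd.
case: (indec [set i | u i \in M]%SET) => [|A0|AT].
- by under eq_bigl => j do rewrite inE.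
- by move/finset.setP/(_ i0): A0; rewrite !inE u0 rpred0.
- by move/finset.setP/(_ i): AT; rewrite !inE.
Qed.

(** Evaluation at [x i0 = 0] gives the sum of the valuations of the other
    [x j]. If they were not all equal, their sum would exceed [n - 1] times
    the least one, and rescaling by an [x j] = [t] that attains it would
    contradict [indecomposable_ideal] for the [x j / t]. *)
Lemma indecomposable_valuation p n (k : 'I_n -> nat) (x : 'I_n -> K)
    (i0 : 'I_n) (N : nat) (r : seq K) :
  place_divides rho p -> prime p ->
  (forall S : {set 'I_n}, (p %| \sum_(i in S) k i)%N ->
     S = finset.set0 \/ S = finset.setT) ->
  x i0 = 0 -> injective x -> (forall i, x i \in M) ->
  {in r, forall y, y \in O /\ y \notin M} -> (0 < N)%N ->
  log_deriv_num k x = N%:R *: \prod_(y <- r) ('X - y%:P) ->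
  forall i, i != i0 -> rho (x i) *+ n.-1 = rho N%:R.
Proof.
move=> rho_p p_prime indec x0 x_inj x_M r_unit N_gt0 G_eq i i_neq.
have N_neq0 := natr_neq0 N_gt0.
have x_neq0 j : j != i0 -> x j != 0.
  by move=> j_neq; rewrite -x0 (inj_eq x_inj).
have k0_M : (k i0)%:R \notin M.
  rewrite (place_divides_natP _ rho_p) //; apply/negP => p_dvd.
  case: (indec [set i0]%SET) => [|A0|AT]; first by rewrite big_set1.
    by move/finset.setP/(_ i0): A0; rewrite !inE eqxx.
  by move/finset.setP/(_ i): AT; rewrite !inE (negPf i_neq).
have card_off : #|[pred j | j != i0]| = n.-1.
  by have := cardC1 i0; rewrite card_ord.
have sum_val : \sum_(j | j != i0) rho (x j) = rho N%:R.
  have prod_M : \prod_(y <- r) (0 - y) \notin M.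
    by apply: prod_notin_ideal => y /r_unit[? ?] _; rewrite sub0r rpredN.
  have prod_O : \prod_(y <- r) (0 - y) \in O.
    rewrite big_seq; apply: rpred_prod => y /r_unit[? _].
    by rewrite sub0r rpredN.
  have off_neq0 j : j != i0 -> 0 - x j != 0.
    by move=> /x_neq0 xj; rewrite sub0r oppr_eq0.
  have := congr1 (horner^~ (x i0)) G_eq.
  rewrite horner_log_deriv_num hornerZ horner_prod x0.
  under [in RHS]eq_bigr => y _ do rewrite hornerXsubC.
  have off_prod_neq0 : \prod_(j | j != i0) (0 - x j) != 0.
    exact/prodf_neq0.
  move/(congr1 rho); rewrite !place_valM ?(val_ideal_neq0 k0_M) //; last first.
    exact: val_ideal_neq0 prod_M.
  rewrite (place_val_unit (rpred_nat _ _) k0_M) (place_val_unit prod_O) //.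
  rewrite add0r addr0 place_val_prod // => <-; apply: eq_bigr => j j_neq.
  by rewrite sub0r place_valN ?x_neq0.
have [j0 j0_neq min_j0] :
    exists2 j0, j0 != i0 & forall j, j != i0 -> rho (x j0) <= rho (x j).
  case: (@arg_minP _ _ _ i (predC1 i0) (fun j => rho (x j)) i_neq).
  by move=> j0 j0_neq min_j0; exists j0.
set t := x j0 in min_j0; have t_neq0 : t != 0 by apply: x_neq0.
have min_sharp : rho N%:R <= rho t *+ n.-1.
  rewrite leNgt; apply/negP => lt_val; pose u j := t^-1 * x j.
  have u_j0 : u j0 = 1 by rewrite /u mulVf.
  have u_O j : u j \in O.
    have [->|j_neq] := eqVneq j i0; first by rewrite /u x0 mulr0 rpred0.
    rewrite unfold_in; apply/orP; right.
    rewrite place_valM ?invr_eq0 ?x_neq0 // place_valV //.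
    by rewrite addrC subr_ge0 min_j0.
  have xE : x =1 (fun j => t * u j) by move=> j; rewrite /u mulVKf.
  have tn_neq0 : t ^+ n.-1 != 0 by rewrite expf_neq0.
  have Gu_M : log_deriv_num k u \is a polyOver M.
    have -> : log_deriv_num k u =
        (N%:R / t ^+ n.-1) *: \prod_(y <- r) (t *: 'X - y%:P).
      apply: (scalerI tn_neq0); rewrite -log_deriv_num_scale scalerA.
      rewrite mulrC divfK //.
      have <- : log_deriv_num k x = log_deriv_num k (fun j => t * u j).
        apply: eq_bigr => j _; congr (_ *: _).
        by apply: eq_bigr => l _; rewrite -xE.
      rewrite G_eq comp_polyZ rmorph_prod /=; congr (_ *: _).
      by apply: eq_bigr => y _; rewrite comp_polyB comp_polyX comp_polyC.
    rewrite -mul_polyC mulrC polyOver_idealM //.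
      rewrite big_seq; apply: rpred_prod => y /r_unit[y_O _].
      rewrite rpredB ?polyOverC // polyOverZ ?polyOverX //.
      exact/val_idealW/x_M.
    rewrite polyOverC unfold_in; apply/orP; right.
    by rewrite place_valM ?invr_eq0 // place_valV // place_valX // subr_gt0.
  have u0 : u i0 = 0 by rewrite /u x0 mulr0.
  have := indecomposable_ideal rho_p p_prime indec u0 u_O Gu_M j0.
  by rewrite u_j0 (negPf one_notin_ideal).
(* The differences rho (x j) - rho t are nonnegative with sum at most 0. *)
have val_t j : j != i0 -> rho (x j) = rho t.
  move=> j_neq; apply/eqP; rewrite -subr_eq0; apply/eqP; move: j j_neq.
  apply: psumr_eq0P => [j j_neq|]; first by rewrite subr_ge0 min_j0.
  apply/le_anti/andP; split; last first.
    by apply: sumr_ge0 => j j_neq; rewrite subr_ge0 min_j0.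
  by rewrite sumrB sum_val sumr_const card_off subr_le0.
rewrite -sum_val (val_t i) // (eq_bigr (fun=> rho t)) //.
by rewrite sumr_const card_off.
Qed.

End FinitePlace.

(** * Normalized models *)

Lemma sum_white_degree (R : realType) (N n m : nat)
    (G : plane_bipartite_graph R N n m) :
  (\sum_i white_degree G i = N)%N.
Proof.
rewrite -[RHS]card_ord -sum1_card (partition_big (wend G) predT) //=.
apply: eq_bigr => i _; rewrite /white_degree -sum1_card.
by apply: eq_bigl => e; rewrite inE.
Qed.

Lemma preimage_seq (I T : eqType) (f : I -> T) (r : seq T) :
  {in r, forall z, exists i, z = f i} -> exists s, r = [seq f i | i <- s].
Proof.
elim: r => [|z r IHr] im; first by exists [::].
have [i ->] : exists i, z = f i by apply: im; rewrite mem_head.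
have [s ->] : exists s, r = [seq f i | i <- s].
  by apply: IHr => w w_in; apply: im; rewrite inE w_in orbT.
by exists (i :: s).
Qed.

Theorem theorem3p1 (R : realType) (p r N n m : nat)
    (p_prime : prime p) (N_eq : N = (p * r)%N) (pr_coprime : coprime p r)
    (T : plane_bipartite_tree R N n m)
    (K : fieldExtType rat) (iota : {rmorphism K -> Cplx R})
    (rho : finite_place K) (rho_p : place_divides rho p)
    (b : {poly Cplx R}) (c : K) (x : 'I_n -> K) (y : 'I_m -> K)
    (b_model : normalized_model T iota rho b c x y)
    (b_eq : b = \prod_(i < n) ('X - (iota (x i))%:P) ^+ white_degree T i)
    (x_first : forall i : 'I_n, i = 0%N :> nat -> x i = 0)
    (T_indec : white_indecomposable p (passport T)) :
  forall i : 'I_n, (0 < i)%N ->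
    ((rho (x i))%:~R : rat) = (rho p%:R)%:~R / (n%:R - 1).
Proof.
move=> i i_gt0; have n_gt0 : (0 < n)%N by apply: leq_ltn_trans (ltn_ord i).
pose i0 := Ordinal n_gt0; have x0 : x i0 = 0 by apply: x_first.
have i_neq : i != i0 by rewrite -val_eqE /= -lt0n.
pose k := white_degree T.
have indec (S : {set 'I_n}) : (p %| \sum_(j in S) k j)%N ->
    S = finset.set0 \/ S = finset.setT.
  move=> p_dvd; have [->|S0] := eqVneq S finset.set0; first by left.
  have [->|ST] := eqVneq S finset.setT; first by right.
  case: T_indec; exists S; split=> //.
  under eq_bigr => j _ do rewrite tnth_mktuple.
  exact: p_dvd.
(* A white vertex of degree 0 alone would be a proper decomposing subset, as
   i and i0 are distinct. *)
have k_gt0 j : (0 < k j)%N.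
  rewrite lt0n; apply/negP => /eqP kj0.
  case: (indec [set j]%SET) => [|A0|AT]; first by rewrite big_set1 kj0 dvdn0.
    by move/finset.setP/(_ j): A0; rewrite !inE eqxx.
  move/finset.setP: AT => AT; have := AT i; have := AT i0.
  rewrite !inE => /eqP eq_i0 /eqP eq_i.
  by rewrite eq_i eq_i0 eqxx in i_neq.
case: b_model => [[_ _ crit [h [iso hx hy]]] _ _ [j1 yj1] x_int y_int].
have x_O j : x j \in val_ring rho.
  by rewrite unfold_in; case: (x_int j) => [->|->]; rewrite ?eqxx ?orbT.
have y_O j : y j \in val_ring rho.
  by rewrite unfold_in; case: (y_int j) => [->|->]; rewrite ?eqxx ?orbT.
have [[_ [g [_ hK _]]] _ _ _ iso_black] := iso.
have x_inj : injective x.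
  move=> j j' eq_x; apply: (@white_inj _ _ _ _ T); apply: (can_inj hK).
  by rewrite !hx /= eq_x.
have N_gt0 : (0 < N)%N.
  rewrite -(sum_white_degree T) (bigD1 i0) //= addn_gt0.
  by rewrite -/(k i0) k_gt0.
pose bK := \prod_j ('X - (x j)%:P) ^+ k j.
have map_bK : map_poly iota bK = b.
  rewrite b_eq rmorph_prod; apply: eq_bigr => j _.
  by rewrite rmorphXn /= map_polyXsubC.
have black_value j : bK.[y j] = c.
  apply: (fmorph_inj iota); rewrite -horner_map map_bK.
  have : [set z | b.[z] = iota c]%classic (h (black T j)).
    by rewrite -iso_black; exists (black T j) => //; exists j.
  by rewrite hy.
have [s G_eq] : exists s : seq 'I_m,
    log_deriv_num k x = N%:R *: \prod_(z <- map y s) ('X - z%:P).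
  have ix_inj : injective (iota \o x) by move=> j j' /fmorph_inj/x_inj.
  have crit' z : root (\prod_j ('X - ((iota \o x) j)%:P) ^+ k j)^`() z ->
      (\prod_j ('X - ((iota \o x) j)%:P) ^+ k j).[z] = 0 \/
      (\prod_j ('X - ((iota \o x) j)%:P) ^+ k j).[z] = iota c.
    by have := crit z; rewrite b_eq.
  have [rts rts_black] := log_deriv_num_roots n_gt0 k_gt0 ix_inj crit'.
  rewrite sum_white_degree -map_log_deriv_num => G_eq.
  have [z z_in|s rts_eq] := @preimage_seq _ _ (iota \o y) rts.
    have : [set z | b.[z] = iota c]%classic z by rewrite /= b_eq rts_black.
    by rewrite -iso_black => -[_ [j _ <-] <-]; exists j; rewrite hy.
  exists s; apply: (map_poly_inj iota); rewrite G_eq rts_eq.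
  by rewrite map_polyZ rmorph_nat map_prod_XsubC !big_map.
have N_M : N%:R \in val_ideal rho.
  by rewrite (place_divides_natP _ rho_p) // N_eq dvdn_mulr.
have x_M : forall j, x j \in val_ideal rho.
  apply: (indecomposable_ideal rho_p p_prime indec x0 x_O).
  rewrite G_eq -mul_polyC mulrC polyOver_idealM ?polyOverC //.
  by rewrite big_map rpred_prod // => j _; rewrite polyOverXsubC.
(* c is the value of b at the black vertex 1, and the 1 - x j are units. *)
have c_M : c \notin val_ideal rho.
  rewrite -(black_value j1) yj1 horner_prod.
  have one_x j : 1 - x j \notin val_ideal rho.
    apply/negP => /(rpredD (x_M j)); rewrite addrC subrK.
    exact/negP/one_notin_ideal.
  apply: prod_notin_ideal => j _ _; rewrite horner_exp hornerXsubC.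
    by rewrite rpredX // rpredB ?rpred1.
  rewrite -prodr_const; apply: prod_notin_ideal => // l _ _.
  by rewrite rpredB ?rpred1.
(* If y j were in the ideal, the factor y j - x i0 of b (y j) = c would be
   there too. *)
have y_M j : y j \notin val_ideal rho.
  apply: contra c_M => yj_M; rewrite -(black_value j) horner_prod.
  rewrite (bigD1 i0) //= mulrC val_idealMr //.
    apply: rpred_prod => l _; rewrite horner_exp hornerXsubC.
    by rewrite rpredX // rpredB.
  rewrite horner_exp hornerXsubC -(prednK (k_gt0 i0)) exprSr.
  by rewrite val_idealMr ?rpredX ?rpredB.
have y_unit : {in map y s, forall z, z \in val_ring rho /\
    z \notin val_ideal rho}.
  by move=> _ /mapP[j _ ->]; split.
have := indecomposable_valuation rho_p p_prime indec x0 x_inj x_M y_unit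
  N_gt0 G_eq i_neq.
have rho_N : rho N%:R = rho p%:R.
  have r_gt0 : (0 < r)%N by move: N_gt0; rewrite N_eq muln_gt0 => /andP[].
  have r_M : r%:R \notin val_ideal rho.
    by rewrite (place_divides_natP _ rho_p) // -prime_coprime.
  rewrite N_eq natrM place_valM ?natr_neq0 ?(prime_gt0 p_prime) //.
  by rewrite (place_val_unit (rpred_nat _ _) r_M) addr0.
have n_gt1 : (1 < n)%N by apply: leq_ltn_trans (ltn_ord i).
have n1_eq : n%:R - 1 = n.-1%:R :> rat.
  by rewrite -subn1 natrB // ltnW.
rewrite rho_N n1_eq => <-; rewrite rmorphMn /= -mulr_natr mulfK //.
by rewrite pnatr_eq0 -lt0n -subn1 subn_gt0.
Qed.
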